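(* Every LA is dominated by an ALA. A function $F(X^*,X)\ge 0$ with domain $\{(X^*,X): X^*\in[1,\infty),\ X\in[0,X^*]\}$ is an ALA if and only if the following two conditions are satisfied: (i) the function $F^{=}(X^* ):=F(X^*,X^* )$, $X^*\in[1,\infty)$, is increasing, concave, and satisfies $F^{=}(1)=1$ and $F^{=}_{\mathrm r}(1)\le 1$; (ii) for each $X^*\in[1,\infty)$, the function $X\mapsto F(X^*,X)$ is linear (i.e. affine) in $X\in[0,X^*]$ and its slope is equal to the right derivative $F^{=}_{\mathrm r}(X^* )$ of $F^{=}$ at the point $X^*$.
   Context: ''Positive'' and ''increasing'' are meant in the non-strict sense. $f_{\mathrm r}$ denotes the right derivative of $f$. Trading game (discrete time, perfect information): $X_0:=1$, $\mathcal K_0:=1$; for $t=1,2,\dots$: Investor announces $p_t\in\mathbb R$, then Market announces $X_t\in[0,\infty)$, and $\mathcal K_t:=\mathcal K_{t-1}+p_t(X_t-X_{t-1})$. Put $X_t^*:=\max_{s\le t}X_s$. A strategy for Investor is a function $\Pi$ from the set of all finite sequences of Market's moves (including the empty one) to $\mathbb R$, prescribing $p_t=\Pi(X_1,\dots,X_{t-1})$. A strategy guarantees a property if the property holds for every infinite sequence $X_1,X_2,\dots\in[0,\infty)$ of Market's moves. A positive (i.e. $[0,\infty)$-valued) function $F(X^*,X)$, where $X^*$ ranges over $[1,\infty)$ and $X$ over $[0,X^*]$, is an LA (lookback adjuster) if there exists a strategy for Investor that guarantees $\mathcal K_t\ge F(X_t^*,X_t)$ for all $t$. An LA $F$ dominates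 an LA $G$ if $F(X^*,X)\ge G(X^*,X)$ for all $X^*\in[1,\infty)$ and $X\in[0,X^*]$; it strictly dominates $G$ if in addition $F(X^*,X)>G(X^*,X)$ for some such $(X^*,X)$. An LA is an ALA (admissible lookback adjuster) if it is not strictly dominated by any LA. *)

(* Defs.v *)
From HB Require Import structures.
From mathcomp Require Import all_boot all_order all_algebra.
From mathcomp Require Import all_classical all_reals all_analysis.

Set Implicit Arguments.
Unset Strict Implicit.
Unset Printing Implicit Defensive.

Import Order.TTheory GRing.Theory Num.Theory.
Import numFieldNormedType.Exports.

Local Open Scope classical_set_scope.
Local Open Scope ring_scope.

(* Market's moves X_1, X_2, ... are encoded as x : nat -> R with x t = X_(t+1);
   price x is the sequence X_0 = 1, X_1, X_2, ... *)
Definition price (R : realType) (x : nat -> R) (t : nat) : R :=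
  if t is s.+1 then x s else 1.

Definition max_price (R : realType) (x : nat -> R) (t : nat) : R :=
  \big[Num.max/1]_(s < t.+1) price x s.

(* Only the values of a strategy on sequences of elements of [0, +oo[ are ever
   used. *)
Definition strategy (R : realType) := seq R -> R.

(* mkseq x s = [:: X_1; ...; X_s] is the information available to Investor
   when announcing p_(s+1). *)
Fixpoint capital (R : realType) (Pi : strategy R) (x : nat -> R) (t : nat) : R :=
  if t is s.+1
  then capital Pi x s + Pi (mkseq x s) * (price x s.+1 - price x s)
  else 1.

(* Functions of (X^*, X) are total functions F : R -> R -> R; only their values
   on this domain are relevant. *)
Definition adj_dom (R : realType) (m X : R) : Prop := 1 <= m /\ 0 <= X <= m.

Definition adj_nonneg (R : realType) (F : R -> R -> R) : Prop :=
  forall m X, adj_dom m X -> 0 <= F m X.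

Definition is_LA (R : realType) (F : R -> R -> R) : Prop :=
  adj_nonneg F /\
  exists Pi : strategy R, forall x : nat -> R, (forall t, 0 <= x t) ->
    forall t, F (max_price x t) (price x t) <= capital Pi x t.

Definition dominates (R : realType) (F G : R -> R -> R) : Prop :=
  forall m X, adj_dom m X -> G m X <= F m X.

Definition strictly_dominates (R : realType) (F G : R -> R -> R) : Prop :=
  dominates F G /\ exists m X, adj_dom m X /\ G m X < F m X.

Definition is_ALA (R : realType) (F : R -> R -> R) : Prop :=
  is_LA F /\ ~ (exists G, is_LA G /\ strictly_dominates G F).

Definition diag_fun (R : realType) (F : R -> R -> R) : R -> R :=
  fun m => F m m.

Definition is_right_derivative (R : realType) (f : R -> R) (x l : R) : Prop :=
  h^-1 * (f (x + h) - f x) @[h --> 0^'+] --> l.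

Definition concave_function (R : realType) (D : set R) (f : R -> R) : Prop :=
  convex_function (D : set (convex_lmodType R^o)) (fun x => - f x).

Definition affine_on_with_slope (R : realType) (D : set R) (f : R -> R)
    (l : R) : Prop :=
  exists a : R, forall x, D x -> f x = a + l * x.

(* Main.v *)
(* Let G be an LA with strategy Pi, and let g(m) be the infimum of the capital
   of Pi over all histories whose last price equals m and is the running
   maximum. The next move from such a history may go up to a new maximum Y or
   down to X, so the positions of Pi yield, in the limit, a slope p(m) with
   g(Y) <= g(m) + p(m)(Y - m) for Y >= m and G(m,X) <= g(m) + p(m)(X - m) for
   X <= m. Let f be the infimum of the affine majorants of g. It is concave,
   f(1) = g(1), and the first inequality passes to f, whence f_r <= p and
   F(m,X) = 1 - g(1) + f(m) + f_r(m)(X - m) dominates G and satisfies (i), (ii).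

   Conversely a function F satisfying (i) and (ii) is an LA by the strategy
   p_t = F^=_r(X^*_(t-1)), and it is maximal: if F' also satisfies (i), (ii) and
   dominates F, then D = F'^= - F^= satisfies D(1) = 0 and
   m D_r(m) <= D(m) (look at X = 0), so that D(m)/m decreases and D = 0. *)

Require Import Defs.
From mathcomp Require Import all_boot all_order all_algebra.
From mathcomp Require Import all_classical all_reals all_analysis.
From mathcomp Require Import ring lra.

Set Implicit Arguments.
Unset Strict Implicit.
Unset Printing Implicit Defensive.

Import Order.TTheory GRing.Theory Num.Theory.
Import numFieldNormedType.Exports.

Local Open Scope classical_set_scope.
Local Open Scope ring_scope.

(** * Concave functions, right derivatives and supporting slopes *)

Lemma concave_functionP (R : realType) (f : R -> R) :
  concave_function `[1, +oo[ f <->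
  forall x y t : R, 1 <= x -> 1 <= y -> 0 <= t <= 1 ->
    t * f x + (1 - t) * f y <= f (t * x + (1 - t) * y).
Proof.
split=> [cf x y t x1 y1 t01|cf t x y].
  have /= := cf (@Itv01 R t (andP t01).1 (andP t01).2) x y.
  rewrite !inE/= !in_itv/= !andbT => /(_ x1 y1).
  rewrite convRE /= /unstable.onem /= => h.
  have -> : t * x + (1 - t) * y = t *: (x : R^o) + (1 - t) *: (y : R^o) by [].
  by move: h; set u := f _; lra.
rewrite !inE/= !in_itv/= !andbT => x1 y1.
have := cf x y t%:num x1 y1.
rewrite convRE /unstable.onem => /(_ _)/wrap[]; first by apply/andP.
have -> : conv t x y = t%:num * x + (1 - t%:num) * y by [].
by set u := f (_ + _); lra.
Qed.

(** Free of division, so that degenerate triples are allowed and comparisons of slopes reduce to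
    linear arithmetic. *)
Lemma concave_chord (R : realType) (f : R -> R) (x y z : R) :
  concave_function `[1, +oo[ f -> 1 <= x -> x <= y -> y <= z ->
  (z - y) * f x + (y - x) * f z <= (z - x) * f y.
Proof.
move=> /concave_functionP cf x1 xy yz.
have [xz|xz] := eqVneq x z.
  by have [-> ->] : y = x /\ z = x; lra.
have zx0 : 0 < z - x by rewrite subr_gt0 lt_neqAle xz (le_trans xy).
set t := (z - y) / (z - x).
have tE : t * (z - x) = z - y by rewrite /t; field; lra.
have t01 : 0 <= t <= 1.
  by rewrite divr_ge0 ?ler_pdivrMr ?mul1r; lra.
have z1 : 1 <= z by lra.
have := cf x z t x1 z1 t01.
have -> : t * x + (1 - t) * z = y by lra.
rewrite -(ler_pM2l zx0); apply: le_trans.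
have -> : y - x = (1 - t) * (z - x) by lra.
by rewrite -tE; lra.
Qed.

Lemma right_derivative_le (R : realType) (f : R -> R) (m d q : R) :
  is_right_derivative f m d ->
  (forall Y, m <= Y -> f Y <= f m + q * (Y - m)) -> d <= q.
Proof.
move=> fd fq; apply: (cvgr_to_le fd).
near=> h; have h0 : 0 < h by near: h; exact: nbhs_right_gt.
rewrite mulrC ler_pdivrMr//.
by have := fq (m + h); lra.
Unshelve. all: by end_near. Qed.

Lemma right_derivative_supergradient (R : realType) (f : R -> R) (m d Y : R) :
  concave_function `[1, +oo[ f -> is_right_derivative f m d ->
  1 <= m -> 1 <= Y -> f Y <= f m + d * (Y - m).
Proof.
move=> cf fd m1 Y1.
have [Ym|mY|->] := ltgtP Y m; last by lra.
  suff : d <= (f m - f Y) / (m - Y).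
    by rewrite ler_pdivlMr; lra.
  apply: (cvgr_to_le fd); near=> h.
  have h0 : 0 < h by near: h; exact: nbhs_right_gt.
  rewrite mulrC ler_pdivrMr// mulrAC ler_pdivlMr ?subr_gt0//.
  have mh : m <= m + h by lra.
  have := concave_chord cf Y1 (ltW Ym) mh; lra.
suff : (f Y - f m) / (Y - m) <= d by rewrite ler_pdivrMr; lra.
apply: (cvgr_to_ge fd); near=> h.
have h0 : 0 < h by near: h; exact: nbhs_right_gt.
have hY : h < Y - m by near: h; apply: nbhs_right_lt; rewrite subr_gt0.
rewrite [leRHS]mulrC ler_pdivlMr// mulrAC ler_pdivrMr ?subr_gt0//.
have mh : m <= m + h by lra.
have mhY : m + h <= Y by lra.
have := concave_chord cf m1 mh mhY; lra.
Unshelve. all: by end_near. Qed.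

(** The difference quotient grows as the step shrinks and is bounded by [q], so it tends to its
    supremum. *)
Lemma concave_right_derivable (R : realType) (f : R -> R) (m q : R) :
  concave_function `[1, +oo[ f -> 1 <= m ->
  (forall Y, m <= Y -> f Y <= f m + q * (Y - m)) ->
  exists d, is_right_derivative f m d.
Proof.
move=> cf m1 fq; pose s h := h^-1 * (f (m + h) - f m).
exists (sup [set s h | h in `]0, +oo[]).
apply: (@nonincreasing_at_right_cvgr R s 0 +oo%O); first by rewrite bnd_simp.
- move=> h k; rewrite !in_itv/= !andbT => h0 k0 hk; rewrite /s.
  rewrite [leLHS]mulrC ler_pdivrMr// -mulrA [leRHS]mulrC ler_pdivlMr//.
  have mh : m <= m + h by lra.
  have mhk : m + h <= m + k by lra.
  have := concave_chord cf m1 mh mhk; lra.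
- exists q => y [h /=]; rewrite in_itv/= andbT => h0 <-; rewrite /s.
  by rewrite mulrC ler_pdivrMr//; have := fq (m + h); lra.
Qed.

(** After a strict drop, concavity keeps [f] below a falling line, which eventually becomes
    negative. *)
Lemma concave_ge0_nondecreasing (R : realType) (f : R -> R) :
  concave_function `[1, +oo[ f -> (forall x, 1 <= x -> 0 <= f x) ->
  {in `[1, +oo[ &, {homo f : x y / x <= y}}.
Proof.
move=> cf f0 x y; rewrite !in_itv/= !andbT => x1 y1 xy.
rewrite leNgt; apply/negP => fyx.
have xy' : 0 < y - x.
  rewrite subr_gt0 lt_neqAle xy andbT; apply: contraTneq fyx => ->.
  by rewrite ltxx.
have fxy : 0 < f x - f y by lra.
have fy0 := f0 _ y1.
pose c := (y - x) / (f x - f y).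
have cE : c * (f x - f y) = y - x by rewrite /c; field; lra.
have c0 : 0 < c by rewrite divr_gt0.
(* the chord through x and y takes the value -1 at z *)
pose z := y + c * (f y + 1).
have yz : y <= z by rewrite lerDl mulr_ge0; lra.
have z1 : 1 <= z by lra.
have fz0 := f0 _ z1.
have := concave_chord cf x1 xy yz.
have : 0 <= (y - x) * f z by rewrite mulr_ge0; lra.
suff : (z - y) * f x - (z - x) * f y = y - x by lra.
have -> : (z - y) * f x - (z - x) * f y =
  (f y + 1) * (c * (f x - f y)) - (y - x) * f y.
  by rewrite /z; ring.
by rewrite cE; ring.
Qed.

(** No limit of the slopes [q] is extracted. Their existence for every [e] shows that each slope of
    [u] to the right of [m] is at most each slope of [v] to the left, and the supremum of the former
    separates the two families. *)
Lemma supporting_slope_limit (R : realType) (u v : R -> R) (c m : R) :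
  0 < m ->
  (forall e, 0 < e -> exists q,
     (forall Y, m <= Y -> u Y <= c + e + q * (Y - m)) /\
     (forall X, 0 <= X <= m -> v X <= c + e + q * (X - m))) ->
  exists q,
     (forall Y, m <= Y -> u Y <= c + q * (Y - m)) /\
     (forall X, 0 <= X <= m -> v X <= c + q * (X - m)).
Proof.
move=> m0 H.
have um : u m <= c.
  apply/ler_addgt0Pr => e /H[q [/(_ _ (lexx m)) + _]]; lra.
have vm : v m <= c.
  apply/ler_addgt0Pr => e /H[q [_ /(_ m)/wrap[]]]; lra.
have slopes X Y : 0 <= X < m -> m < Y ->
    (u Y - c) / (Y - m) <= (c - v X) / (m - X).
  move=> /andP[X0 Xm] mY.
  rewrite ler_pdivrMr ?subr_gt0// mulrAC ler_pdivlMr ?subr_gt0//.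
  apply/ler_addgt0Pr => e e0.
  have YX0 : 0 < Y - X by lra.
  (* Weighting the two bounds by [m - X] and [Y - m] cancels [q] and leaves the error times [Y - X],
     hence this choice. *)
  have [q [/(_ Y (ltW mY)) hY hX]] := H _ (divr_gt0 e0 YX0).
  have {}hX : v X <= c + e / (Y - X) + q * (X - m) by apply: hX; lra.
  set e' := e / _ in hX hY.
  have -> : e = e' * (Y - X) by rewrite /e'; field; lra.
  have : (u Y) * (m - X) <= (c + e' + q * (Y - m)) * (m - X).
    by rewrite ler_wpM2r; lra.
  have : (v X) * (Y - m) <= (c + e' + q * (X - m)) * (Y - m).
    by rewrite ler_wpM2r; lra.
  lra.
set S := [set (u Y - c) / (Y - m) | Y in `]m, +oo[].
have S0 : S !=set0.
  by eexists; exists (m + 1) => //=; rewrite in_itv/= andbT; lra.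
have ubS X : 0 <= X < m -> ubound S ((c - v X) / (m - X)).
  move=> Xm y [Y /=]; rewrite in_itv/= andbT => mY <-; exact: slopes.
exists (sup S); split=> [Y|X /andP[X0]].
  rewrite le_eqVlt => /predU1P[<-|mY]; first by lra.
  rewrite -lerBlDl -ler_pdivrMr ?subr_gt0//; apply: ub_le_sup.
    by exists ((c - v 0) / (m - 0)); apply: ubS; lra.
  by exists Y => //=; rewrite in_itv/= andbT.
rewrite le_eqVlt => /predU1P[->|Xm]; first by lra.
have /(ge_sup S0) : ubound S ((c - v X) / (m - X)) by apply: ubS; lra.
by rewrite ler_pdivlMr; lra.
Qed.

(** * Price paths and their continuation by one move *)

Lemma max_price0 (R : realType) (x : nat -> R) : max_price x 0 = 1.
Proof. by rewrite /max_price big_ord_recl big_ord0 /= maxxx. Qed.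

Lemma max_priceS (R : realType) (x : nat -> R) (t : nat) :
  max_price x t.+1 = Num.max (max_price x t) (price x t.+1).
Proof.
apply/le_anti/andP; split.
  apply: bigmax_le => [|i _]; first by rewrite le_max bigmax_ge_id.
  have [it|it] := ltnP i t.+1.
    by rewrite le_max (le_bigmax _ (fun i : 'I_t.+1 => price x i) (Ordinal it)).
  have -> : nat_of_ord i = t.+1 by apply/eqP; rewrite eqn_leq it -ltnS ltn_ord.
  by rewrite le_max lexx orbT.
rewrite ge_max (le_bigmax _ (fun i : 'I_t.+2 => price x i) ord_max) andbT.
apply: bigmax_le => [|i _]; first exact: bigmax_ge_id.
exact: (le_bigmax _ (fun i : 'I_t.+2 => price x i) (widen_ord (leqnSn _) i)).
Qed.

Lemma max_price_ge1 (R : realType) (x : nat -> R) (t : nat) :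
  1 <= max_price x t.
Proof. exact: bigmax_ge_id. Qed.

Lemma price_le_max (R : realType) (x : nat -> R) (t : nat) :
  price x t <= max_price x t.
Proof. by case: t => [|t]; rewrite ?max_price0// max_priceS le_max lexx orbT. Qed.

(** Moves up to time [t] are kept and the price at time [t.+1] is [Y]; repeating [Y] afterwards
    merely completes an infinite path. *)
Definition extend_path (R : realType) (x : nat -> R) (t : nat) (Y : R) :
    nat -> R :=
  fun s => if (s < t)%N then x s else Y.

Lemma extend_path_ge0 (R : realType) (x : nat -> R) (t : nat) (Y : R) :
  (forall s, 0 <= x s) -> 0 <= Y -> forall s, 0 <= extend_path x t Y s.
Proof. by move=> x0 Y0 s; rewrite /extend_path; case: ifP. Qed.

Lemma price_extend (R : realType) (x : nat -> R) (t : nat) (Y : R) (s : nat) :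
  (s <= t)%N -> price (extend_path x t Y) s = price x s.
Proof. by case: s => //= s st; rewrite /extend_path st. Qed.

Lemma max_price_extend (R : realType) (x : nat -> R) (t : nat) (Y : R)
    (s : nat) :
  (s <= t)%N -> max_price (extend_path x t Y) s = max_price x s.
Proof.
elim: s => [|s IH] st; first by rewrite !max_price0.
by rewrite !max_priceS IH ?(ltnW st)// price_extend.
Qed.

Lemma mkseq_extend (R : realType) (x : nat -> R) (t : nat) (Y : R) (s : nat) :
  (s <= t)%N -> mkseq (extend_path x t Y) s = mkseq x s.
Proof.
move=> st; apply/eq_in_map => i; rewrite mem_iota add0n /= => si.
by rewrite /extend_path (leq_trans si st).
Qed.

Lemma capitalS (R : realType) (Pi : strategy R) (x : nat -> R) (t : nat) :
  capital Pi x t.+1 =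
  capital Pi x t + Pi (mkseq x t) * (price x t.+1 - price x t).
Proof. by []. Qed.

Lemma capital_extend (R : realType) (Pi : strategy R) (x : nat -> R) (t : nat)
    (Y : R) (s : nat) :
  (s <= t)%N -> capital Pi (extend_path x t Y) s = capital Pi x s.
Proof.
elim: s => [|s IH]// st; have st' := ltnW st.
by rewrite !capitalS IH// mkseq_extend// !price_extend.
Qed.

Lemma price_extendS (R : realType) (x : nat -> R) (t : nat) (Y : R) :
  price (extend_path x t Y) t.+1 = Y.
Proof. by rewrite /= /extend_path ltnn. Qed.

Lemma max_price_extendS (R : realType) (x : nat -> R) (t : nat) (Y : R) :
  max_price (extend_path x t Y) t.+1 = Num.max (max_price x t) Y.
Proof. by rewrite max_priceS max_price_extend// price_extendS. Qed.

Lemma capital_extendS (R : realType) (Pi : strategy R) (x : nat -> R) (t : nat)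
    (Y : R) :
  capital Pi (extend_path x t Y) t.+1 =
  capital Pi x t + Pi (mkseq x t) * (Y - price x t).
Proof.
by rewrite capitalS price_extendS capital_extend// mkseq_extend// price_extend.
Qed.

(** * From an LA to a dominating function that satisfies (i) and (ii) *)

Definition capitals_at_record (R : realType) (Pi : strategy R) (m : R) : set R :=
  [set K | exists x t, [/\ forall s, 0 <= x s, max_price x t = m,
                           price x t = m & K = capital Pi x t]].

Lemma capitals_at_record_extend (R : realType) (Pi : strategy R)
    (x : nat -> R) (t : nat) (Y : R) :
  (forall s, 0 <= x s) -> 0 <= Y -> max_price x t <= Y ->
  capitals_at_record Pi Y
    (capital Pi x t + Pi (mkseq x t) * (Y - price x t)).
Proof.
move=> x0 Y0 mY; exists (extend_path x t Y), t.+1; split.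
- exact: extend_path_ge0.
- by rewrite max_price_extendS max_r.
- exact: price_extendS.
- by rewrite capital_extendS.
Qed.

Lemma adj_dom_diag (R : realType) (m : R) : 1 <= m -> adj_dom m m.
Proof. by move=> m1; split=> //; rewrite lexx andbT; lra. Qed.

Lemma adj_dom0 (R : realType) (m : R) : 1 <= m -> adj_dom m 0.
Proof. by move=> m1; split=> //; rewrite lexx /=; lra. Qed.

(** At a history with capital within [e] of the infimum [g m], Investor's next position is a slope
    valid up to the error [e]; [supporting_slope_limit] removes the error. *)
Lemma LA_supporting_slopes (R : realType) (G : R -> R -> R) :
  is_LA G -> exists g p : R -> R, g 1 <= 1 /\
    forall m, 1 <= m ->
      (forall Y, m <= Y -> g Y <= g m + p m * (Y - m)) /\
      (forall X, 0 <= X <= m -> G m X <= g m + p m * (X - m)).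
Proof.
move=> [G0 [Pi GPi]]; pose g m := inf (capitals_at_record Pi m).
have S0 m : 1 <= m -> capitals_at_record Pi m !=set0.
  move=> m1; eexists.
  apply: (@capitals_at_record_extend R Pi (fun=> 0) 0%N m) => //; first lra.
  by rewrite max_price0.
have Slb m : 1 <= m -> has_lbound (capitals_at_record Pi m).
  move=> m1; exists 0 => K [x [t [x0 xm xt ->]]].
  apply: le_trans (GPi _ x0 t); rewrite xm xt.
  exact/G0/adj_dom_diag.
have slope m : 1 <= m -> exists q,
     (forall Y, m <= Y -> g Y <= g m + q * (Y - m)) /\
     (forall X, 0 <= X <= m -> G m X <= g m + q * (X - m)).
  move=> m1; apply: supporting_slope_limit; first lra.
  move=> e e0; have [K] := inf_adherent e0 (conj (S0 _ m1) (Slb _ m1)).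
  move=> [x [t [x0 xm xt ->]]] /ltW Ke; exists (Pi (mkseq x t)).
  have {}Ke : capital Pi x t <= g m + e by [].
  split=> [Y mY|X /andP[X0 Xm]].
    have Y0 : 0 <= Y by lra.
    rewrite -xm in mY.
    have := ge_inf (Slb Y _) (capitals_at_record_extend Pi x0 Y0 mY).
    by rewrite xt -/(g Y) => /(_ _)/wrap[]; lra.
  have := GPi _ (extend_path_ge0 t x0 X0) t.+1.
  by rewrite max_price_extendS price_extendS capital_extendS xm xt max_l//; lra.
have /choice[p pP] m : exists q, 1 <= m ->
   (forall Y, m <= Y -> g Y <= g m + q * (Y - m)) /\
   (forall X, 0 <= X <= m -> G m X <= g m + q * (X - m)).
  have [/slope[q qP]|m1] := boolP (1 <= m); first by exists q.
  by exists 0.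
exists g, p; split=> //; apply: ge_inf; first exact: Slb.
(* Time [0] is itself a record at price [1], with capital [1]. *)
by exists (fun=> 0), 0%N; rewrite max_price0; split.
Qed.

(** An affine majorant of slope at most [p m] rises from [m] to [Y] by at most [p m * (Y - m)]; a
    steeper one can be replaced by one of slope exactly [p m] with the same value at [m]. *)
Lemma concave_majorant (R : realType) (g p : R -> R) :
  (forall m Y, 1 <= m -> m <= Y -> g Y <= g m + p m * (Y - m)) ->
  exists f : R -> R, [/\ concave_function `[1, +oo[ f, f 1 = g 1,
    forall m, 1 <= m -> g m <= f m &
    forall m Y, 1 <= m -> m <= Y -> f Y <= f m + p m * (Y - m)].
Proof.
move=> gp.
pose L : set (R * R) := [set l | forall y, 1 <= y -> g y <= l.1 + l.2 * y].
pose f x := inf [set l.1 + l.2 * x | l in L].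
have fle x l : 1 <= x -> L l -> f x <= l.1 + l.2 * x.
  move=> x1 Ll; apply: ge_inf; last by exists l.
  by exists (g x) => _ [l' Ll' <-]; exact: Ll'.
(* Pairs are (intercept, slope). This line passes through [(1, g 1)], which makes [L] nonempty and
   forces [f 1 = g 1]. *)
have L1 : L (g 1 - p 1, p 1) by move=> y y1 /=; have := gp 1 y (lexx _) y1; lra.
have lef x c : (forall l, L l -> c <= l.1 + l.2 * x) -> c <= f x.
  move=> h; apply: lb_le_inf; first by eexists; exists (g 1 - p 1, p 1).
  by move=> _ [l Ll <-]; exact: h.
have gf m : 1 <= m -> g m <= f m by move=> m1; apply: lef => l; exact.
exists f; split=> //.
- apply/concave_functionP => x y t x1 y1 /andP[t0 t1]; apply: lef => l Ll.
  have hx : t * f x <= t * (l.1 + l.2 * x) by rewrite ler_wpM2l// fle.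
  have hy : (1 - t) * f y <= (1 - t) * (l.1 + l.2 * y).
    by rewrite ler_wpM2l ?subr_ge0// fle.
  lra.
- apply/le_anti; rewrite gf// andbT.
  by have := fle 1 _ (lexx _) L1; rewrite /=; lra.
- move=> m Y m1 mY; rewrite -lerBlDr; apply: lef => l Ll; rewrite lerBlDr.
  have [lp|pl] := leP l.2 (p m).
    apply: le_trans (fle Y l _ Ll) _; first lra.
    have : l.2 * (Y - m) <= p m * (Y - m) by rewrite ler_wpM2r ?subr_ge0.
    lra.
  (* tilting l about the point m down to the slope p m keeps it above g *)
  have Ll' : L (l.1 + l.2 * m - p m * m, p m).
    move=> y y1 /=; have [ym|/ltW my] := leP y m.
      have := Ll _ y1.
      have : p m * (m - y) <= l.2 * (m - y).
        by rewrite ler_wpM2r ?subr_ge0// ltW.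
      lra.
    by have := gp _ _ m1 my; have := Ll _ m1; lra.
  by have := fle Y _ (le_trans m1 mY) Ll'; rewrite /=; lra.
Qed.

(** Written exactly as in the theorem, so that the two forms are convertible. *)
Definition ALA_conditions (R : realType) (F : R -> R -> R) : Prop :=
  ({in `[1, +oo[ &, {homo diag_fun F : x y / x <= y}} /\
   concave_function `[1, +oo[ (diag_fun F) /\
   diag_fun F 1 = 1 /\
   (exists d : R, is_right_derivative (diag_fun F) 1 d /\ d <= 1)) /\
  (forall m : R, 1 <= m ->
     exists d : R, is_right_derivative (diag_fun F) m d /\
                   affine_on_with_slope `[0, m] (F m) d).

Lemma LA_dominated (R : realType) (G : R -> R -> R) :
  is_LA G ->
  exists F, [/\ adj_nonneg F, ALA_conditions F & dominates F G].
Proof.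
move=> GLA; have G0 := GLA.1.
have [g [p [g1 gp]]] := LA_supporting_slopes GLA.
have gp' m Y : 1 <= m -> m <= Y -> g Y <= g m + p m * (Y - m).
  by move=> m1; apply: (gp m m1).1.
have Gp m X : 1 <= m -> 0 <= X <= m -> G m X <= g m + p m * (X - m).
  by move=> m1; apply: (gp m m1).2.
have [f [cf f1 gf fp]] := concave_majorant gp'.
have /choice[d dP] m : exists d, 1 <= m -> is_right_derivative f m d.
  have [m1|m1] := boolP (1 <= m); last by exists 0.
  have [d dP] := concave_right_derivable cf m1 (fun Y => @fp m Y m1).
  by exists d.
have dp m : 1 <= m -> d m <= p m.
  by move=> m1; apply: right_derivative_le (dP _ m1) (fun Y => @fp m Y m1).
(* The shift [c] is nonnegative because [g 1 <= 1], so it normalises the diagonal at [1] without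
   losing domination. *)
pose c := 1 - g 1; pose F m X := c + f m + d m * (X - m).
have diagF : diag_fun F = fun m => c + f m.
  by apply/funext => m; rewrite /diag_fun /F subrr mulr0 addr0.
have FG : dominates F G.
  move=> m X [m1 /andP[X0 Xm]].
  have h1 : G m X <= g m + p m * (X - m) by apply: Gp => //; rewrite X0.
  have h2 := gf _ m1.
  have : d m * (m - X) <= p m * (m - X) by rewrite ler_wpM2r ?subr_ge0// dp.
  by rewrite /F /c; lra.
have F0 : adj_nonneg F by move=> m X mX; apply: le_trans (FG _ _ mX); exact: G0.
have cF : concave_function `[1, +oo[ (diag_fun F).
  rewrite diagF; apply/concave_functionP => x y t x1 y1 t01.
  by move/concave_functionP: cf => /(_ x y t x1 y1 t01); lra.
have dF m : 1 <= m -> is_right_derivative (diag_fun F) m (d m).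
  move=> /dP; rewrite diagF /is_right_derivative.
  suff -> : (fun h => h^-1 * (c + f (m + h) - (c + f m))) =
            (fun h => h^-1 * (f (m + h) - f m)) by [].
  by apply/funext => h; ring.
exists F; split=> //; split; last first.
  move=> m m1; exists (d m); split; first exact: dF.
  by exists (c + f m - d m * m) => X _; rewrite /F; ring.
split.
  by apply: concave_ge0_nondecreasing => // m m1; exact/F0/adj_dom_diag.
split=> //; split; first by rewrite diagF /c f1; ring.
exists (d 1); split; first exact: dF.
apply: le_trans (dp _ (lexx _)) _.
(* Evaluation at [m = 1], [X = 0] gives [0 <= G 1 0 <= g 1 - p 1], hence [p 1 <= g 1 <= 1]. *)
have h01 : 0 <= (0 : R) <= 1 by rewrite lexx ler01.
have := Gp _ _ (lexx 1) h01.
by have := G0 _ _ (adj_dom0 (lexx 1)); have := g1; lra.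
Qed.

(** * Sufficiency of the conditions: the LA property and maximality *)

(** Replaces derivatives by inequalities: [d m] is a supergradient of the diagonal at [m], and the
    least one to the right of [m]. No limits are needed afterwards. *)
Lemma ALA_conditions_tangents (R : realType) (F : R -> R -> R) :
  ALA_conditions F -> exists d : R -> R, F 1 1 = 1 /\ forall m, 1 <= m ->
    [/\ forall X, 0 <= X <= m -> F m X = F m m + d m * (X - m),
        forall Y, 1 <= Y -> F Y Y <= F m m + d m * (Y - m) &
        forall q, (forall Y, m <= Y -> F Y Y <= F m m + q * (Y - m)) ->
          d m <= q].
Proof.
move=> [[_ [cF [F1 _]]] aff].
have /choice[d dP] m : exists d, 1 <= m ->
    is_right_derivative (diag_fun F) m d /\
    affine_on_with_slope `[0, m] (F m) d.
  have [/aff[d dP]|m1] := boolP (1 <= m); first by exists d.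
  by exists 0.
exists d; split=> // m m1; have [dm [a aP]] := dP _ m1; split.
- move=> X X0m; rewrite !aP /= ?in_itv//=; first by ring.
  by rewrite lexx andbT; lra.
- by move=> Y Y1; apply: (right_derivative_supergradient cF dm).
- by move=> q; exact: right_derivative_le.
Qed.

(** Holding [d m] moves the capital parallel to the tangent at [m]. Below [m] this tangent is [F m]
    itself, and above [m] it majorises the diagonal. *)
Lemma ALA_conditions_is_LA (R : realType) (F : R -> R -> R) :
  adj_nonneg F -> ALA_conditions F -> is_LA F.
Proof.
move=> F0 /ALA_conditions_tangents[d [F1 dP]]; split=> //.
exists (fun s => d (foldl Num.max 1 s)) => x x0.
have maxE t : foldl Num.max 1 (mkseq x t) = max_price x t.
  elim: t => [|t IH]; first by rewrite max_price0.
  by rewrite max_priceS -IH mkseqS foldl_rcons.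
elim=> [|t IH]; first by rewrite max_price0 /= F1.
rewrite capitalS maxE max_priceS.
set m := max_price x t in IH *; set X := price x t in IH *.
have m1 : 1 <= m by exact: max_price_ge1.
have X0m : 0 <= X <= m.
  by rewrite price_le_max andbT /X; case: (t) => //=.
have [aff super _] := dP _ m1.
rewrite aff// in IH.
set Y := price x t.+1; have Y0 : 0 <= Y by exact: x0.
have [Ym|mY] := leP Y m; first by rewrite aff ?Y0//; lra.
by have := super Y (ltW (le_lt_trans m1 mY)); lra.
Qed.

(** The ratio [D m / m] is followed along a grid of step [e] instead of being differentiated: the
    errors telescope to a bound of order [e], which vanishes as the grid is refined. *)
Lemma ALA_conditions_maximal (R : realType) (F F' : R -> R -> R) :
  ALA_conditions F -> ALA_conditions F' -> dominates F' F ->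
  forall m X, adj_dom m X -> F' m X = F m X.
Proof.
move=> /ALA_conditions_tangents[d [F1 dP]] /ALA_conditions_tangents[d' [F'1 dP']].
move=> FF'.
pose D m := F' m m - F m m.
have D0 m : 1 <= m -> 0 <= D m by move=> /adj_dom_diag/FF'; rewrite subr_ge0.
have Dslope m : 1 <= m -> (d' m - d m) * m <= D m.
  move=> m1; have := FF' _ _ (adj_dom0 m1).
  have [aff _ _] := dP _ m1; have [aff' _ _] := dP' _ m1.
  have m0 : 0 <= (0 : R) <= m by rewrite lexx /=; lra.
  by rewrite aff// aff'// /D; lra.
have d_noninc m Y : 1 <= m -> m <= Y -> d Y <= d m.
  move=> m1 mY; have Y1 := le_trans m1 mY.
  have [<-//|mneY] := eqVneq m Y.
  have mY' : 0 < Y - m by rewrite subr_gt0 lt_neqAle mneY.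
  have [_ /(_ m m1) superY _] := dP _ Y1.
  have [_ /(_ Y Y1) superm _] := dP _ m1.
  by rewrite -(ler_pM2r mY'); lra.
(* a discrete version, with step e, of the decrease of D(m)/m *)
have D_step e m : 0 <= e -> 1 <= m -> D m <= m * e * (d 1 - d m) ->
    D (m + e) <= (m + e) * e * (d 1 - d (m + e)).
  move=> e0 m1 IH; have me1 : 1 <= m + e by lra.
  (* The tangent to [F] at [m + e], read at [m], and the tangent to [F'] at [m], read at [m + e],
     bound the increment of [D] by [(d' m - d (m + e)) * e]. *)
  have [_ super _] := dP _ me1; have {super} := super _ m1.
  have [_ super _] := dP' _ m1; have {super} := super _ me1.
  have dd : d (m + e) <= d m by apply: d_noninc; lra.
  have Dm := Dslope _ m1.
  set Y := m + e in me1 dd *.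
  have m0 : 0 < m by lra.
  move=> super' super.
  have DY : D Y <= D m + (d' m - d Y) * e.
    by move: super super'; rewrite /D /Y; lra.
  have h1 : m * D Y <= m * (D m + (d' m - d Y) * e) by rewrite ler_wpM2l// ltW.
  have h2 : e * ((d' m - d m) * m) <= e * D m by rewrite ler_wpM2l.
  have h3 : Y * D m <= Y * (m * e * (d 1 - d m)) by rewrite ler_wpM2l//; lra.
  (* As [1 <= Y], the new error [e * (d m - d Y)] is at most [Y] times itself, so it joins the
     telescoping sum. *)
  have h4 : 0 <= m * ((Y - 1) * (e * (d m - d Y))).
    by rewrite !mulr_ge0//; lra.
  rewrite -(ler_pM2l m0).
  have YE : Y * D m = m * D m + e * D m by rewrite /Y; ring.
  lra.
have Dbound e n : 0 <= e ->
    D (1 + n%:R * e) <= (1 + n%:R * e) * e * (d 1 - d (1 + n%:R * e)).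
  move=> e0; elim: n => [|n IH].
    by rewrite mul0r addr0 /D F1 F'1 !subrr mulr0.
  have -> : 1 + n.+1%:R * e = 1 + n%:R * e + e by rewrite -natr1; ring.
  by apply: D_step => //; rewrite lerDl mulr_ge0.
have DE m : 1 <= m -> D m = 0.
  move=> m1; apply/le_anti; rewrite D0// andbT.
  set C := m * (m - 1) * (d 1 - d m).
  (* With [n.+1] steps from [1] to [m], the bound on [D m] is [C / n.+1], and [C] does not depend on
     [n]. *)
  have nD n : n.+1%:R * D m <= C.
    have n0 : n.+1%:R != 0 :> R by rewrite pnatr_eq0.
    have e0 : 0 <= (m - 1) / n.+1%:R by rewrite divr_ge0 ?subr_ge0.
    have := Dbound _ n.+1 e0.
    have -> : 1 + n.+1%:R * ((m - 1) / n.+1%:R) = m by field.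
    rewrite -(ler_pM2l (ltr0Sn R n)).
    suff -> : n.+1%:R * (m * ((m - 1) / n.+1%:R) * (d 1 - d m)) = C by [].
    by rewrite /C; field.
  rewrite leNgt; apply/negP => Dm.
  have C0 : 0 <= C / D m.
    by rewrite divr_ge0 ?D0//; have := nD 0%N; rewrite mul1r; lra.
  have := archi_boundP C0; set n := Num.bound _.
  rewrite ltr_pdivrMr//; have := nD n; rewrite -natr1; lra.
have diagE m : 1 <= m -> F' m m = F m m.
  by move=> /DE/eqP; rewrite subr_eq0 => /eqP.
move=> m X [m1 X0m].
have [aff _ least] := dP _ m1; have [aff' super' _] := dP' _ m1.
(* The diagonals now agree, so [d' m] is a competitor for the least slope [d m]; the reverse
   inequality is [Dslope] with [D m = 0]. *)
have dd' : d m <= d' m.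
  apply: least => Y mY; have Y1 := le_trans m1 mY.
  by rewrite -!diagE//; exact: super'.
have d'd : d' m <= d m.
  by have := Dslope _ m1; rewrite DE// pmulr_lle0 ?subr_le0//; lra.
rewrite aff// aff'// diagE//; congr (_ + _ * _).
by apply/le_anti; rewrite dd' d'd.
Qed.

(** * Necessity of the conditions and conclusion *)

(** Maximality yields equality only on the domain. The conditions see nothing else, since a right
    derivative at [m >= 1] involves only points beyond [m]. *)
Lemma ALA_conditions_eq (R : realType) (F F' : R -> R -> R) :
  (forall m X, adj_dom m X -> F' m X = F m X) ->
  ALA_conditions F' -> ALA_conditions F.
Proof.
move=> E [[incF [cF [F1 [d1 [rd1 d1le]]]]] aff].
have E' m : 1 <= m -> diag_fun F' m = diag_fun F m.
  by move=> m1; exact/E/adj_dom_diag.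
have rdE m d : 1 <= m -> is_right_derivative (diag_fun F') m d ->
    is_right_derivative (diag_fun F) m d.
  move=> m1; apply: cvg_trans; apply: near_eq_cvg; near=> h.
  have h0 : 0 < h by near: h; exact: nbhs_right_gt.
  by rewrite !E'//; lra.
split; last first.
  move=> m m1; have [d [rd [a aP]]] := aff _ m1; exists d; split; first exact: rdE.
  exists a => X X0m; have Xm : 0 <= X <= m by move: X0m; rewrite /= in_itv.
  by rewrite -(aP _ X0m) E.
split=> [x y xI yI xy|].
  have x1 : 1 <= x by move: xI; rewrite in_itv/= andbT.
  have y1 : 1 <= y by move: yI; rewrite in_itv/= andbT.
  by rewrite -!E'//; exact: incF.
split.
  apply/concave_functionP => x y t x1 y1 t01.
  move/concave_functionP : cF => /(_ x y t x1 y1 t01).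
  rewrite !E'//.
  by case/andP: t01; nra.
split; first by rewrite -E'.
by exists d1; split=> //; apply: rdE.
Unshelve. all: by end_near. Qed.

Unset Implicit Arguments.

Theorem theorem4p1 (R : realType) :
  (forall G : R -> R -> R, is_LA G ->
     exists F : R -> R -> R, is_ALA F /\ dominates F G) /\
  (forall F : R -> R -> R, adj_nonneg F ->
     (is_ALA F <->
      ((* (i) *)
       ({in `[1, +oo[ &, {homo diag_fun F : x y / x <= y}} /\
        concave_function `[1, +oo[ (diag_fun F) /\
        diag_fun F 1 = 1 /\
        (exists d : R, is_right_derivative (diag_fun F) 1 d /\ d <= 1))
       /\
       (* (ii) *)
       (forall m : R, 1 <= m ->
          exists d : R, is_right_derivative (diag_fun F) m d /\
                        affine_on_with_slope `[0, m] (F m) d)))).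
Proof.
have sufficient (F : R -> R -> R) :
    adj_nonneg F -> ALA_conditions F -> is_ALA F.
  move=> F0 cF; split; first exact: ALA_conditions_is_LA.
  (* A strictly better [G] would lie below some [F'] satisfying the conditions, but maximality
     forces [F' = F] on the domain. *)
  move=> [G [/LA_dominated[F' [_ cF' F'G]] [GF [m [X [mX FltG]]]]]].
  have F'F : dominates F' F.
    by move=> ? ? mX'; apply: le_trans (GF _ _ mX') (F'G _ _ mX').
  have := F'G _ _ mX; rewrite (ALA_conditions_maximal cF cF' F'F mX).
  by rewrite leNgt FltG.
split=> [G /LA_dominated[F [F0 cF FG]]|F F0].
  by exists F; split=> //; exact: sufficient.
split=> [[FLA maxF]|cF]; last exact: sufficient.
(* Since [F'] is an LA, admissibility of [F] makes this domination an equality on the domain. *)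
have [F' [F'0 cF' F'F]] := LA_dominated FLA.
apply: (ALA_conditions_eq _ cF') => m X mX; apply/le_anti/andP; split.
  rewrite leNgt; apply/negP => FltF'; apply: maxF; exists F'.
  by split; [exact: ALA_conditions_is_LA|split=> //; exists m, X].
exact: F'F.
Qed.
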